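(* Suppose that $\lambda_0,\lambda_1,\lambda_2,\lambda_3$ are real numbers. Then the values $\sigma(x)$, $-\sigma(-x)$, $\rho(x)$ and $-\rho(-x)$ are positive for all $x>0$.
   Context: For $(\mu_0,\dots,\mu_N)\in\mathbb{C}^{N+1}$ let $\Phi_{(\mu_0,\dots,\mu_N)}$ (the fundamental function) be the unique solution of $\prod_{j=0}^N(\frac{d}{dx}-\mu_j)\Phi=0$ on $\mathbb{R}$ with $\Phi^{(k)}(0)=0$ for $k=0,\dots,N-1$ and $\Phi^{(N)}(0)=1$. Define for $x\ne0$ (for real exponents the denominators vanish only at $0$) $$\rho(x)=\frac{\Phi'_{(\lambda_0,\dots,\lambda_3)}(x)\Phi_{(\lambda_0,\lambda_1)}(x)-\Phi_{(\lambda_0,\dots,\lambda_3)}(x)\Phi'_{(\lambda_0,\lambda_1)}(x)}{\Phi_{(\lambda_0,\lambda_1)}(x)\Phi_{(\lambda_2,\lambda_3)}(x)},\qquad \sigma(x)=\frac{\Phi_{(\lambda_0,\dots,\lambda_3)}(x)}{\Phi_{(\lambda_0,\lambda_1)}(x)\Phi_{(\lambda_2,\lambda_3)}(x)}.$$ *)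

(* Defs.v *)
From Stdlib Require Import Reals List Lia ClassicalEpsilon.
From Coquelicot Require Import Coquelicot.
Import ListNotations.
Open Scope R_scope.

(* Coquelicot's total derivative [Derive] is only defined for real-valued
   functions; for f : R -> C it is taken componentwise.  See
   [is_derive_CDerive] for the agreement with [is_derive]. *)
Definition CDerive (f : R -> C) (x : R) : C :=
  (Derive (fun t => Re (f t)) x, Derive (fun t => Im (f t)) x).

Fixpoint CDerive_n (k : nat) (f : R -> C) : R -> C :=
  match k with
  | O => f
  | S k => CDerive (CDerive_n k f)
  end.

(* C is regarded as a normed space over R. *)
Definition ex_Cderive (f : R -> C) (x : R) : Prop :=
  @ex_derive R_AbsRing C_R_NormedModule f x.

Lemma is_derive_CDerive (f : R -> C) (x : R) (l : C) :
  @is_derive R_AbsRing C_R_NormedModule f x l -> CDerive f x = l.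
Proof.
intros H; destruct l as [a b]; unfold CDerive; f_equal; apply is_derive_unique.
- exact (filterdiff_comp' (V := C_R_NormedModule) f fst x _ fst H
    (filterdiff_linear fst is_linear_fst)).
- exact (filterdiff_comp' (V := C_R_NormedModule) f snd x _ snd H
    (filterdiff_linear snd is_linear_snd)).
Qed.

(* (d/dx - mu_0) ... (d/dx - mu_N) f for mu = [mu_0; ...; mu_N] *)
Definition diff_op (mu : list C) (f : R -> C) : R -> C :=
  fold_right (fun m g x => (CDerive g x - m * g x)%C) f mu.

(* For mu = [mu_0; ...; mu_N], N is [pred (length mu)].  Only nonempty lists
   are meaningful: no f satisfies this for mu = []. *)
Definition is_fundamental (mu : list C) (f : R -> C) : Prop :=
  let N := pred (length mu) in
  (forall k, (k < length mu)%nat -> forall x, ex_Cderive (CDerive_n k f) x) /\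
  (forall x, diff_op mu f x = 0%C) /\
  (forall k, (k < N)%nat -> CDerive_n k f 0 = 0%C) /\
  CDerive_n N f 0 = 1%C.

Definition Phi (mu : list C) : R -> C :=
  epsilon (inhabits (fun _ => 0%C)) (is_fundamental mu).

(* Coquelicot's [Cinv 0] is 0, so the quotients below take the value 0 where
   their denominator vanishes. *)
Definition rho_fun (l0 l1 l2 l3 : C) (x : R) : C :=
  ((CDerive (Phi [l0; l1; l2; l3]) x * Phi [l0; l1] x
    - Phi [l0; l1; l2; l3] x * CDerive (Phi [l0; l1]) x)
   / (Phi [l0; l1] x * Phi [l2; l3] x))%C.

Definition sigma_fun (l0 l1 l2 l3 : C) (x : R) : C :=
  (Phi [l0; l1; l2; l3] x / (Phi [l0; l1] x * Phi [l2; l3] x))%C.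

Definition Cpos (z : C) : Prop := Im z = 0 /\ 0 < Re z.

(* Main.v *)
Require Import Defs.
From Stdlib Require Import Reals List Lia Lra ClassicalEpsilon Permutation.
From Coquelicot Require Import Coquelicot.
Import ListNotations.
Open Scope R_scope.

(** For real exponents the fundamental function is real, so everything reduces
    to signs of real solutions of linear equations with constant coefficients
    and real roots.  All the sign information comes from one first-order fact
    ([first_order_sign]): if [f' = m f + g], [f 0 = 0] and [g] has the sign of
    [x ^ n] away from [0], then [f] has the sign of [x ^ (n + 1)] there.

    Removing the innermost factor [d/dx - m] from the operator turns the
    fundamental function of [mu ++ [m]] into the fundamental function of [mu]
    ([real_fundamental_snoc]).  By induction the fundamental function of
    [N + 1] exponents has the sign of [x ^ N] ([real_fundamental_sign]).  Hence
    [Phi_(l0,l1)] and [Phi_(l2,l3)] have the sign of [x], their product is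
    positive, and [Phi_(l0,..,l3)] has the sign of [x ^ 3]; this settles
    [sigma].

    For [rho], put [p = Phi_(l0,..,l3)], [u = Phi_(l0,l1)] and
    [q = (d/dx - l0)(d/dx - l1) p].  The factors commute
    ([real_fundamental_perm]), so [q] is the fundamental function of
    [(l2, l3)] and has the sign of [x].  The numerator [W = p' u - p u']
    vanishes at [0] and satisfies [W' = (l0 + l1) W + u q]: [p]
    and [u] satisfy the same second-order equation up to the inhomogeneity
    [q], so the terms in [p u] cancel.  As [u q > 0] away from [0], the first-order fact gives
    [W] the sign of [x] ([wronskian_sign]).

    Since [Phi] is obtained by choice, its characteristic properties also
    require a solution to exist; one is built by adding one factor at a time
    with Duhamel's integral ([real_fundamental_exists]). *)

(** * Real initial value problems *)

Fixpoint rdiff_op (mu : list R) (f : R -> R) : R -> R :=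
  match mu with
  | [] => f
  | m :: mu => fun x => Derive (rdiff_op mu f) x - m * rdiff_op mu f x
  end.

Definition regular (n : nat) (f : R -> R) : Prop :=
  forall k, (k < n)%nat -> forall x, ex_derive (Derive_n f k) x.

(** The vanishing conditions and the normalisation of the highest derivative
    form one family indexed by [k], because removing a factor of the operator
    acts on all of them by the same shift of index. *)
Definition real_fundamental (mu : list R) (f : R -> R) : Prop :=
  regular (length mu) f /\
  (forall x, rdiff_op mu f x = 0) /\
  (forall k, (k < length mu)%nat ->
     Derive_n f k 0 = if Nat.eqb (S k) (length mu) then 1 else 0).

Lemma is_derive_eq (f : R -> R) (x l l' : R) :
  is_derive f x l -> l = l' -> is_derive f x l'.
Proof. now intros H <-. Qed.

Lemma rdiff_op_ext mu f g :
  (forall x, f x = g x) -> forall x, rdiff_op mu f x = rdiff_op mu g x.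
Proof.
induction mu as [|m mu IH]; simpl; intros Hfg x; auto.
now rewrite (IH Hfg x), (Derive_ext _ _ x (IH Hfg)).
Qed.

Lemma rdiff_op_app mu nu f x :
  rdiff_op (mu ++ nu) f x = rdiff_op mu (rdiff_op nu f) x.
Proof.
revert x; induction mu as [|m mu IH]; simpl; intros x; auto.
now rewrite IH, (Derive_ext _ _ x IH).
Qed.

(** Derivatives of [f' - m f] are split only up to the order for which [f] is
    known to be differentiable: [Derive] is additive only under such a
    hypothesis. *)
Lemma Derive_n_first_order n m f k :
  regular (S n) f -> (k <= n)%nat -> forall x,
  Derive_n (fun t => Derive f t - m * f t) k x =
  Derive_n f (S k) x - m * Derive_n f k x.
Proof.
intros Hf; induction k as [|k IH]; intros Hk x; auto.
change (Derive (Derive_n (fun t => Derive f t - m * f t) k) x =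
        Derive (Derive_n f (S k)) x - m * Derive (Derive_n f k) x).
rewrite (Derive_ext _ _ x (IH ltac:(lia))).
rewrite Derive_minus; [|apply Hf; lia|apply ex_derive_scal, Hf; lia].
now rewrite Derive_scal.
Qed.

Lemma regular_first_order n m f :
  regular (S n) f -> regular n (fun t => Derive f t - m * f t).
Proof.
intros Hf k Hk x.
apply ex_derive_ext with (fun t => Derive_n f (S k) t - m * Derive_n f k t).
- intros t; symmetry; apply (Derive_n_first_order n); auto with arith.
- apply @ex_derive_minus; [apply Hf; lia|apply ex_derive_scal, Hf; lia].
Qed.

Lemma regular_rdiff_op n mu f :
  regular (n + length mu) f -> regular n (rdiff_op mu f).
Proof.
revert n; induction mu as [|m mu IH]; simpl; intros n Hf.
- now rewrite Nat.add_0_r in Hf.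
- apply regular_first_order, IH.
  now rewrite Nat.add_succ_l, <- Nat.add_succ_r.
Qed.

(** The right-hand side is symmetric in [a] and [b]: the factors commute. *)
Lemma rdiff_op2 a b f x :
  regular 2 f ->
  rdiff_op [a; b] f x = Derive_n f 2 x - (a + b) * Derive f x + a * b * f x.
Proof.
intros Hf.
assert (H : Derive (fun t => Derive f t - b * f t) x =
            Derive_n f 2 x - b * Derive f x)
  by exact (Derive_n_first_order 1 b f 1 Hf (le_n _) x).
change (Derive (fun t => Derive f t - b * f t) x - a * (Derive f x - b * f x) =
        Derive_n f 2 x - (a + b) * Derive f x + a * b * f x).
rewrite H; ring.
Qed.

Lemma rdiff_op_perm mu nu f :
  Permutation mu nu -> regular (length mu) f ->
  forall x, rdiff_op mu f x = rdiff_op nu f x.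
Proof.
intros Hp; induction Hp as [|m mu nu Hp IH|a b mu|mu nu xi H1 IH1 H2 IH2];
  intros Hf x.
- reflexivity.
- assert (E : forall t, rdiff_op mu f t = rdiff_op nu f t).
  { apply IH; intros k Hk; apply Hf; simpl; lia. }
  simpl; now rewrite E, (Derive_ext _ _ x E).
- assert (H : regular 2 (rdiff_op mu f)) by (apply regular_rdiff_op; exact Hf).
  change (rdiff_op ([b; a] ++ mu) f x = rdiff_op ([a; b] ++ mu) f x).
  rewrite !rdiff_op_app, !rdiff_op2 by exact H; ring.
- rewrite IH1 by exact Hf; apply IH2.
  now rewrite <- (Permutation_length H1).
Qed.

Lemma real_fundamental_perm mu nu f :
  Permutation mu nu -> real_fundamental mu f -> real_fundamental nu f.
Proof.
intros Hp [Hr [He Hi]]; unfold real_fundamental.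
rewrite <- (Permutation_length Hp); repeat split; auto.
intros x; now rewrite <- (rdiff_op_perm _ _ _ Hp Hr).
Qed.

(** With [g = f' - m f], the value [g^(k)(0) = f^(k+1)(0) - m f^(k)(0)] is the
    next initial value of [f], as [f^(k)(0)] still vanishes for these [k]. *)
Lemma real_fundamental_snoc mu m f :
  real_fundamental (mu ++ [m]) f ->
  real_fundamental mu (fun t => Derive f t - m * f t).
Proof.
unfold real_fundamental; rewrite length_app, Nat.add_comm; simpl (_ + _)%nat.
intros [Hr [He Hi]]; split; [|split].
- now apply regular_first_order.
- intros x; rewrite <- (He x), rdiff_op_app; reflexivity.
- intros k Hk.
  rewrite (Derive_n_first_order (length mu)) by (auto; lia).
  rewrite (Hi (S k)), (Hi k) by lia.
  destruct (Nat.eqb_spec (S k) (S (length mu))); [lia|].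
  simpl; ring.
Qed.

Lemma real_fundamental_app mu nu f :
  real_fundamental (mu ++ nu) f -> real_fundamental mu (rdiff_op nu f).
Proof.
revert mu; induction nu as [|m nu IH]; intros mu H.
- now rewrite app_nil_r in H.
- apply (real_fundamental_snoc mu m (rdiff_op nu f)), IH.
  now rewrite <- app_assoc.
Qed.

(** * Signs of solutions *)

(** The mean value theorem for [exp (- m x) * f x].  The condition
    [0 < x * xi] records that [xi] lies on the same side of [0] as [x], which
    treats both half-lines together. *)
Lemma first_order_mean_value (m : R) (f g : R -> R) :
  (forall x, is_derive f x (m * f x + g x)) ->
  forall x, x <> 0 -> exists xi,
    0 < x * xi /\
    f x = exp (m * x) * f 0 + x * (exp (m * (x - xi)) * g xi).
Proof.
intros Hf x Hx.
assert (Hh : forall t, derivable_pt_lim (fun t => exp (- (m * t)) * f t) t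
                         (exp (- (m * t)) * g t)).
{ intros t; apply is_derive_Reals.
  eapply is_derive_eq.
  - apply @is_derive_mult; [|apply Hf|exact Rmult_comm].
    auto_derive; [trivial|reflexivity].
  - unfold plus, mult; simpl; ring. }
assert (HM : exists xi, 0 < x * xi /\
   exp (- (m * x)) * f x - exp (- (m * 0)) * f 0 = exp (- (m * xi)) * g xi * x).
{ destruct (Rlt_or_le x 0) as [Hn|Hp].
  - destruct (MVT_cor2 _ _ x 0 Hn (fun c _ => Hh c)) as [xi [E Hxi]].
    exists xi; split; [nra|simpl in E; lra].
  - destruct (MVT_cor2 _ _ 0 x ltac:(lra) (fun c _ => Hh c)) as [xi [E Hxi]].
    exists xi; split; [nra|simpl in E; lra]. }
destruct HM as [xi [Hs E]]; exists xi; split; [exact Hs|].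
rewrite Rmult_0_r, Ropp_0, exp_0 in E.
replace (m * (x - xi)) with (m * x + - (m * xi)) by ring.
rewrite exp_plus.
replace (exp (m * x) * f 0 + x * (exp (m * x) * exp (- (m * xi)) * g xi))
  with (exp (m * x) * (1 * f 0 + exp (- (m * xi)) * g xi * x)) by ring.
rewrite <- E.
replace (exp (m * x) * (1 * f 0 + (exp (- (m * x)) * f x - 1 * f 0)))
  with (exp (m * x) * exp (- (m * x)) * f x) by ring.
rewrite <- exp_plus, Rplus_opp_r, exp_0; ring.
Qed.

(** The inequality [0 < x ^ n * g x] says that [g x] has the sign of [x ^ n].
    The sign of [g] is transported from the mean value point to [x] because
    both lie on the same side of [0]; the factor [x] of the increment raises
    the exponent by one. *)
Lemma first_order_sign (n : nat) (m : R) (f g : R -> R) :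
  (forall x, is_derive f x (m * f x + g x)) -> f 0 = 0 ->
  (forall x, x <> 0 -> 0 < x ^ n * g x) ->
  forall x, x <> 0 -> 0 < x ^ S n * f x.
Proof.
intros Hf H0 Hg x Hx.
destruct (first_order_mean_value m f g Hf x Hx) as [xi [Hs E]].
assert (Hxi : xi <> 0) by (intros Z; rewrite Z in Hs; lra).
rewrite E, H0.
assert (Hg' := Hg xi Hxi).
assert (Hpow : 0 < x ^ n * xi ^ n)
  by (rewrite <- Rpow_mult_distr; now apply pow_lt).
assert (Hxg : 0 < x ^ n * g xi).
(* [(x ^ n * g xi) * (xi ^ n) ^ 2 = (x ^ n * xi ^ n) * (xi ^ n * g xi)] *)
{ apply Rmult_lt_reg_r with (xi ^ n * xi ^ n).
  - assert (xi ^ n <> 0) by now apply pow_nonzero.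
    nra.
  - nra. }
replace (x ^ S n * (exp (m * x) * 0 + x * (exp (m * (x - xi)) * g xi)))
  with ((x * x) * exp (m * (x - xi)) * (x ^ n * g xi)) by (simpl; ring).
assert (0 < exp (m * (x - xi))) by apply exp_pos.
assert (0 < x * x) by nra.
apply Rmult_lt_0_compat; [apply Rmult_lt_0_compat|]; assumption.
Qed.

Lemma real_fundamental_first_order mu m f :
  real_fundamental (mu ++ [m]) f ->
  forall x, is_derive f x (m * f x + (Derive f x - m * f x)).
Proof.
intros [Hr _] x; eapply is_derive_eq.
- apply Derive_correct, (Hr 0%nat); rewrite length_app; simpl; lia.
- ring.
Qed.

(** The base case is [f = exp (m x)]; every further factor raises the exponent
    by one through [first_order_sign]. *)
Lemma real_fundamental_sign mu f :
  (0 < length mu)%nat -> real_fundamental mu f ->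
  forall x, x <> 0 -> 0 < x ^ pred (length mu) * f x.
Proof.
revert f; induction mu as [|m mu IH] using rev_ind; simpl; intros f Hmu H x Hx.
- lia.
- assert (Hd := real_fundamental_first_order _ _ _ H).
  assert (Hs := real_fundamental_snoc _ _ _ H).
  assert (H0 := proj2 (proj2 H) 0%nat ltac:(rewrite length_app; simpl; lia)).
  rewrite length_app, Nat.add_comm in H0 |- *.
  destruct mu as [|a mu]; simpl in H0 |- *.
  + destruct (first_order_mean_value _ _ _ Hd x Hx) as [xi [_ E]].
    assert (Z := proj1 (proj2 Hs) xi); simpl in Z.
    rewrite E, Z, H0.
    assert (0 < exp (m * x)) by apply exp_pos.
    lra.
  + apply (first_order_sign (length mu) m f _ Hd H0); auto.
    apply (IH _ ltac:(simpl; lia) Hs).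
Qed.

(** * Existence *)

Definition duhamel (m : R) (g : R -> R) (x : R) : R :=
  exp (m * x) * RInt (fun t => exp (- (m * t)) * g t) 0 x.

Lemma is_derive_duhamel (m : R) (g : R -> R) (x : R) :
  (forall t, ex_derive g t) ->
  is_derive (duhamel m g) x (m * duhamel m g x + g x).
Proof.
intros Hg.
assert (Hc : forall t, continuous (fun t => exp (- (m * t)) * g t) t).
{ intros t; apply (@ex_derive_continuous R_AbsRing R_NormedModule).
  apply @ex_derive_mult; [auto_derive; trivial|apply Hg]. }
unfold duhamel; eapply is_derive_eq.
- apply @is_derive_mult; [| |exact Rmult_comm].
  + auto_derive; [trivial|reflexivity].
  + apply (is_derive_RInt (V := R_NormedModule)) with (a := 0).
    * apply filter_forall; intros b.
      apply (@RInt_correct R_CompleteNormedModule), @ex_RInt_continuous; auto.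
    * apply Hc.
- unfold plus, mult; simpl.
  replace (exp (m * x) * (exp (- (m * x)) * g x))
    with (exp (m * x + - (m * x)) * g x) by (rewrite exp_plus; ring).
  rewrite Rplus_opp_r, exp_0; ring.
Qed.

(** The equation [f' = m f + g] makes [f] one order more regular than [g]. *)
Lemma duhamel_regular n m g :
  regular n g -> (0 < n)%nat ->
  regular (S n) (duhamel m g).
Proof.
intros Hg Hn.
assert (Hd : forall x, is_derive (duhamel m g) x (m * duhamel m g x + g x)).
{ intros x; apply is_derive_duhamel, (Hg 0%nat Hn). }
assert (H : forall k, (k <= n)%nat -> forall x,
  ex_derive (Derive_n (duhamel m g) k) x /\
  Derive_n (duhamel m g) (S k) x =
    m * Derive_n (duhamel m g) k x + Derive_n g k x).
{ induction k as [|k IH]; intros Hk x.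
  - split; [eexists; apply Hd|apply is_derive_unique, Hd].
  - assert (E := fun t => proj2 (IH ltac:(lia) t)).
    assert (D := fun t => proj1 (IH ltac:(lia) t)).
    assert (Dg : forall t, ex_derive (Derive_n g k) t) by (apply Hg; lia).
    split.
    + apply ex_derive_ext with
        (fun t => m * Derive_n (duhamel m g) k t + Derive_n g k t);
        [intros t; now rewrite E|].
      apply @ex_derive_plus; [apply ex_derive_scal, D|apply Dg].
    + change (Derive (Derive_n (duhamel m g) (S k)) x =
        m * Derive (Derive_n (duhamel m g) k) x + Derive (Derive_n g k) x).
      rewrite (Derive_ext _ _ x E), Derive_plus, Derive_scal; auto.
      apply ex_derive_scal, D. }
intros k Hk x; apply H; lia.
Qed.

(** Converse of [real_fundamental_snoc].  For empty [mu] the function [g] is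
    zero and the integral misses the normalisation [f 0 = 1], so the induction
    for existence starts from one exponent. *)
Lemma real_fundamental_duhamel mu m g :
  (0 < length mu)%nat -> real_fundamental mu g ->
  real_fundamental (mu ++ [m]) (duhamel m g).
Proof.
intros Hmu [Hr [He Hi]].
assert (Hd : forall x, Derive (duhamel m g) x - m * duhamel m g x = g x).
{ intros x.
  rewrite (is_derive_unique _ _ _ (is_derive_duhamel m g x (Hr 0%nat Hmu))).
  ring. }
assert (Hreg := duhamel_regular _ m _ Hr Hmu).
unfold real_fundamental; rewrite length_app, Nat.add_comm; simpl (_ + _)%nat.
split; [exact Hreg|split].
- intros x; rewrite rdiff_op_app, <- (He x); now apply rdiff_op_ext.
- assert (H0 : duhamel m g 0 = 0)
    by (unfold duhamel; rewrite RInt_point; apply Rmult_0_r).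
  induction k as [|k IH]; intros Hk.
  + destruct (Nat.eqb_spec 1 (S (length mu))); [lia|exact H0].
  + assert (E := Derive_n_first_order _ m _ k Hreg ltac:(lia) 0).
    rewrite (Derive_n_ext _ g k 0 Hd), (Hi k ltac:(lia)) in E.
    rewrite IH in E by lia.
    destruct (Nat.eqb_spec (S k) (S (length mu))); [lia|].
    change (Nat.eqb (S (S k)) (S (length mu))) with (Nat.eqb (S k) (length mu)).
    lra.
Qed.

Lemma real_fundamental_exists mu :
  (0 < length mu)%nat -> exists f, real_fundamental mu f.
Proof.
induction mu as [|m mu IH] using rev_ind; [simpl; lia|intros _].
destruct mu as [|a mu].
- exists (fun x => exp (m * x)); split; [|split]; simpl.
  + intros [|k] Hk x; [simpl; auto_derive; trivial|simpl in Hk; lia].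
  + intros x; rewrite (is_derive_unique _ _ (m * exp (m * x))).
    * ring.
    * auto_derive; [trivial|ring].
  + intros [|k] Hk; [|lia]; simpl; now rewrite Rmult_0_r, exp_0.
- destruct IH as [g Hg]; [simpl; lia|].
  exists (duhamel m g); apply real_fundamental_duhamel; [simpl; lia|exact Hg].
Qed.

(** * Passage from complex to real functions *)

Lemma CDerive_RtoC f x :
  CDerive (fun t => RtoC (f t)) x = RtoC (Derive f x).
Proof.
unfold CDerive; simpl; now rewrite Derive_const.
Qed.

Lemma CDerive_ext F G x :
  (forall t, F t = G t) -> CDerive F x = CDerive G x.
Proof.
intros H; unfold CDerive; f_equal; apply Derive_ext; intros t; now rewrite H.
Qed.

Lemma CDerive_n_RtoC k f x :
  CDerive_n k (fun t => RtoC (f t)) x = RtoC (Derive_n f k x).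
Proof.
revert x; induction k as [|k IH]; intros x; [reflexivity|].
exact (eq_trans (CDerive_ext _ _ x IH) (CDerive_RtoC _ x)).
Qed.

Lemma diff_op_RtoC mu f x :
  diff_op (map RtoC mu) (fun t => RtoC (f t)) x = RtoC (rdiff_op mu f x).
Proof.
revert x; induction mu as [|m mu IH]; intros x; [reflexivity|].
change (diff_op (map RtoC (m :: mu)) (fun t => RtoC (f t)) x) with
  (CDerive (diff_op (map RtoC mu) (fun t => RtoC (f t))) x
   - RtoC m * diff_op (map RtoC mu) (fun t => RtoC (f t)) x)%C.
rewrite (CDerive_ext _ _ x IH), CDerive_RtoC, IH, <- RtoC_mult, <- RtoC_minus.
reflexivity.
Qed.

Lemma ex_Cderive_RtoC f x :
  ex_Cderive (fun t => RtoC (f t)) x <-> ex_derive f x.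
Proof.
split; intros [l Hl].
- apply ex_derive_filterdiff; eexists.
  exact (filterdiff_comp' (V := C_R_NormedModule) (fun t => RtoC (f t)) fst x
    _ fst Hl (filterdiff_linear fst is_linear_fst)).
- apply ex_derive_ext with
    (fun t => scal (f t) (RtoC 1 : C_R_NormedModule)).
  + intros t; unfold scal, RtoC; simpl; unfold prod_scal, scal; simpl;
      unfold mult; simpl; f_equal; ring.
  + eexists; apply @is_derive_scal_l; exact Hl.
Qed.

Lemma is_fundamental_RtoC mu f :
  (0 < length mu)%nat ->
  is_fundamental (map RtoC mu) (fun t => RtoC (f t)) <-> real_fundamental mu f.
Proof.
intros Hmu; unfold is_fundamental, real_fundamental, regular.
rewrite length_map; split.
- intros [Hr [He [Hi H1]]]; split; [|split].
  + intros k Hk x; apply ex_Cderive_RtoC.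
    generalize (Hr k Hk x); apply ex_derive_ext.
    intros t; apply CDerive_n_RtoC.
  + intros x; apply RtoC_inj; rewrite <- diff_op_RtoC; apply He.
  + intros k Hk; apply RtoC_inj; rewrite <- CDerive_n_RtoC.
    destruct (Nat.eqb_spec (S k) (length mu)) as [E|E].
    * rewrite <- E in H1; exact H1.
    * apply Hi; lia.
- intros [Hr [He Hi]]; split; [|split; [|split]].
  + intros k Hk x.
    apply ex_derive_ext with (fun t => RtoC (Derive_n f k t)).
    * intros t; symmetry; apply CDerive_n_RtoC.
    * apply ex_Cderive_RtoC, Hr, Hk.
  + intros x; rewrite diff_op_RtoC; now rewrite He.
  + intros k Hk; rewrite CDerive_n_RtoC, Hi by lia.
    destruct (Nat.eqb_spec (S k) (length mu)); [lia|reflexivity].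
  + rewrite CDerive_n_RtoC, Hi by lia.
    destruct (Nat.eqb_spec (S (pred (length mu))) (length mu));
      [reflexivity|lia].
Qed.

(** The choice operator in [Phi] ranges over real-valued functions, embedded
    into the complex numbers; a real solution is therefore exactly what is
    needed for it to choose a fundamental function. *)
Lemma Phi_real mu :
  (0 < length mu)%nat ->
  exists f, real_fundamental mu f /\
    forall x, Phi (map RtoC mu) x = RtoC (f x) /\
              CDerive (Phi (map RtoC mu)) x = RtoC (Derive f x).
Proof.
intros Hmu.
assert (Hex : exists f, is_fundamental (map RtoC mu) (fun t => RtoC (f t))).
{ destruct (real_fundamental_exists mu Hmu) as [g Hg].
  exists g; now apply is_fundamental_RtoC. }
eexists; split; [|intros x; split].
- apply (is_fundamental_RtoC mu _ Hmu).
  exact (epsilon_spec (inhabits (fun _ => 0)) _ Hex).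
- reflexivity.
- exact (CDerive_RtoC _ x).
Qed.

(** * The numerator of rho *)

(** The first-order equation of the Wronskian has the inhomogeneity [u q], a
    product of two functions with the sign of [x], hence positive on both sides
    of [0]. *)
Lemma wronskian_sign a b c d p u :
  real_fundamental [a; b; c; d] p -> real_fundamental [a; b] u ->
  forall x, x <> 0 -> 0 < x * (Derive p x * u x - p x * Derive u x).
Proof.
intros Hp Hu x Hx.
set (q := rdiff_op [a; b] p).
assert (Hq : real_fundamental [c; d] q).
{ apply real_fundamental_app, (real_fundamental_perm [a; b; c; d]); [|exact Hp].
  exact (Permutation_app_comm [a; b] [c; d]). }
assert (Hpr : regular 2 p) by (intros k Hk; apply Hp; simpl; lia).
assert (Hur : regular 2 u) by apply Hu.
assert (Hqu : forall t, t <> 0 -> 0 < t ^ 0 * (u t * q t)).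
{ intros t Ht.
  assert (A := real_fundamental_sign [a; b] u ltac:(simpl; lia) Hu t Ht).
  assert (B := real_fundamental_sign [c; d] q ltac:(simpl; lia) Hq t Ht).
  simpl in A, B |- *; rewrite Rmult_1_r in A, B.
  destruct (Rdichotomy t 0 Ht); nra. }
replace (x * (Derive p x * u x - p x * Derive u x))
  with (x ^ 1 * (Derive p x * u x - p x * Derive u x)) by ring.
apply (first_order_sign 0 (a + b)
  (fun t => Derive p t * u t - p t * Derive u t) (fun t => u t * q t));
  auto.
- intros t; eapply is_derive_eq.
  + apply @is_derive_minus; (apply @is_derive_mult; [| |exact Rmult_comm]);
      apply Derive_correct.
    * apply (Hpr 1%nat); lia.
    * apply (Hur 0%nat); lia.
    * apply (Hpr 0%nat); lia.
    * apply (Hur 1%nat); lia.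
  + assert (A := rdiff_op2 a b p t Hpr); fold q in A.
    assert (B := rdiff_op2 a b u t Hur).
    rewrite (proj1 (proj2 Hu) t) in B.
    change (Derive_n p 2 t) with (Derive (Derive p) t) in A.
    change (Derive_n u 2 t) with (Derive (Derive u) t) in B.
    rewrite A; unfold minus, plus, opp, mult; simpl.
    change (fun x0 => Derive u x0) with (Derive u).
    replace (Derive (Derive u) t)
      with ((a + b) * Derive u t - a * b * u t) by lra.
    ring.
- assert (P0 := proj2 (proj2 Hp) 0%nat ltac:(simpl; lia)).
  assert (U0 := proj2 (proj2 Hu) 0%nat ltac:(simpl; lia)).
  simpl in P0, U0; rewrite P0, U0; ring.
Qed.

(** * Positivity of sigma and rho *)

Lemma Cpos_RtoC r : 0 < r -> Cpos (RtoC r).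
Proof. now split. Qed.

Theorem theorem29 :
  forall l0 l1 l2 l3 : R, forall x : R, 0 < x ->
    Cpos (sigma_fun (RtoC l0) (RtoC l1) (RtoC l2) (RtoC l3) x) /\
    Cpos (- sigma_fun (RtoC l0) (RtoC l1) (RtoC l2) (RtoC l3) (- x))%C /\
    Cpos (rho_fun (RtoC l0) (RtoC l1) (RtoC l2) (RtoC l3) x) /\
    Cpos (- rho_fun (RtoC l0) (RtoC l1) (RtoC l2) (RtoC l3) (- x))%C.
Proof.
intros l0 l1 l2 l3 x Hx.
destruct (Phi_real [l0; l1; l2; l3] ltac:(simpl; lia)) as [p [Hp Ep]].
destruct (Phi_real [l0; l1] ltac:(simpl; lia)) as [u [Hu Eu]].
destruct (Phi_real [l2; l3] ltac:(simpl; lia)) as [v [Hv Ev]].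
simpl in Ep, Eu, Ev.
assert (Su := real_fundamental_sign [l0; l1] u ltac:(simpl; lia) Hu).
assert (Sv := real_fundamental_sign [l2; l3] v ltac:(simpl; lia) Hv).
assert (Sp := real_fundamental_sign [l0; l1; l2; l3] p ltac:(simpl; lia) Hp).
simpl in Su, Sv, Sp.
assert (Suv : forall t, t <> 0 -> 0 < u t * v t).
{ intros t Ht.
  assert (A := Su t Ht); assert (B := Sv t Ht).
  destruct (Rdichotomy t 0 Ht); nra. }
assert (Sp' : forall t, t <> 0 -> 0 < t * p t).
{ intros t Ht; assert (A := Sp t Ht); assert (0 < t * t) by nra.
  apply Rmult_lt_reg_l with (t * t); lra. }
assert (SW := wronskian_sign l0 l1 l2 l3 p u Hp Hu).
assert (Hdiv : forall t n, t <> 0 -> 0 < t * n -> 0 < t * (n / (u t * v t))).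
{ intros t n Ht Hn; unfold Rdiv; rewrite <- Rmult_assoc.
  apply Rmult_lt_0_compat; [exact Hn|]; now apply Rinv_0_lt_compat, Suv. }
assert (Es : forall t, t <> 0 ->
  sigma_fun (RtoC l0) (RtoC l1) (RtoC l2) (RtoC l3) t =
  RtoC (p t / (u t * v t))).
{ intros t Ht; unfold sigma_fun.
  rewrite (proj1 (Ep t)), (proj1 (Eu t)), (proj1 (Ev t)).
  rewrite <- RtoC_mult, <- RtoC_div; auto.
  all: apply Rgt_not_eq, Suv, Ht. }
assert (Er : forall t, t <> 0 ->
  rho_fun (RtoC l0) (RtoC l1) (RtoC l2) (RtoC l3) t =
  RtoC ((Derive p t * u t - p t * Derive u t) / (u t * v t))).
{ intros t Ht; unfold rho_fun.
  rewrite (proj1 (Ep t)), (proj1 (Eu t)), (proj1 (Ev t)),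
    (proj2 (Ep t)), (proj2 (Eu t)).
  rewrite <- !RtoC_mult, <- RtoC_minus, <- RtoC_div; auto.
  all: apply Rgt_not_eq, Suv, Ht. }
assert (H1 : x <> 0) by lra.
assert (H2 : - x <> 0) by lra.
rewrite !Es, !Er, <- !RtoC_opp by assumption.
assert (P1 := Hdiv x _ H1 (Sp' x H1)).
assert (P2 := Hdiv (- x) _ H2 (Sp' (- x) H2)).
assert (P3 := Hdiv x _ H1 (SW x H1)).
assert (P4 := Hdiv (- x) _ H2 (SW (- x) H2)).
repeat split; apply Cpos_RtoC; apply Rmult_lt_reg_l with x; lra.
Qed.
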